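(* Consider weighted scale-free percolation $\mathrm{SFP}_{W,L}$ on $\mathbb{Z}^d$ with $\lambda>0$, $\alpha>d$, $\tau>1$, $\gamma=\alpha(\tau-1)/d>2$ and $F_L(0)=0$. There exist deterministic constants $C,\widetilde C>0$ (depending only on the distributions of $W$ and $L$ for the given model parameters, but not on the realization of the graph) such that for every $x\in\mathbb{Z}^d$ there are random constants $n_0(x)\in\mathbb{N}$, $t_0(x)\in\mathbb{R}$ (depending on the realization of the graph and on $x$) such that, almost surely, for all $n\ge n_0(x)$ and all $t\ge t_0(x)$, $$B_n^G(x)\subset B^2_{\exp\{Cn\}}(x),\qquad B_t^L(x)\subset B^2_{\exp\{\widetilde Ct\}}(x).$$
   Context: Scale-free percolation model. Fix $d\ge1$, $\alpha>d$ and $\lambda>0$. Each $x\in\mathbb{Z}^d$ gets an i.i.d. vertex-weight $W_x$ distributed as $W$, where $\mathbb{P}(W\ge1)=1$ and $\mathbb{P}(W>t)=\ell(t)/t^{\tau-1}$, with $\tau>1$ and $\ell$ slowly varying at infinity. Conditionally on $(W_x)_{x\in\mathbb{Z}^d}$, edges are present independently: each pair $x,y$ with $\|x-y\|=1$ (Euclidean norm) is always connected by an edge, and each pair with $\|x-y\|>1$ is connected with probability $1-\exp\{-\lambda W_xW_y/\|x-y\|^\alpha\}$. Then every present edge $e$ is given an i.i.d. edge-weight $L_e\ge0$ distributed as $L$, independent of everything else; the resulting weighted graph is $\mathrm{SFP}_{W,L}$. Set $\gamma:=\alpha(\tau-1)/d$ and $F_L(t)=\mathbb{P}(L\le t)$.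 $\mathrm{d}_L(x,y)$ is the infimum over paths $\pi$ from $x$ to $y$ of $\sum_{e\in\pi}L_e$; $\mathrm{d}_G$ is the graph distance. $B_r^2(x)=\{y\in\mathbb{Z}^d:\|x-y\|\le r\}$, $B_n^G(x)=\{y:\mathrm{d}_G(x,y)\le n\}$, $B_t^L(x)=\{y:\mathrm{d}_L(x,y)\le t\}$. *)

(* Defs.v *)
From HB Require Import structures.
From mathcomp Require Import all_boot all_order all_algebra finmap.
From mathcomp Require Import all_classical all_reals all_analysis.

Set Implicit Arguments.
Unset Strict Implicit.
Unset Printing Implicit Defensive.

Import Order.TTheory GRing.Theory Num.Theory.
Import numFieldNormedType.Exports.

Local Open Scope classical_set_scope.
Local Open Scope ring_scope.

Section Lattice.
Context {R : realType} {d : nat}.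

Definition enorm (v : 'rV[int]_d) : R :=
  Num.sqrt (\sum_(i < d) ((v 0 i)%:~R) ^+ 2).

Definition eball (x : 'rV[int]_d) (r : R) : set 'rV[int]_d :=
  [set y | enorm (x - y) <= r].

End Lattice.

Definition slowly_varying {R : realType} (l : R -> R) : Prop :=
  [/\ measurable_fun (`]0, +oo[ : set R) l,
      \forall t \near +oo, 0 < l t &
      forall c : R, 0 < c -> l (c * t) / l t @[t --> +oo] --> (1 : R)].

Section Independence.
Context {R : realType} {disp : measure_display} {Omega : measurableType disp}.
Variable P : probability Omega R.

Definition generated_by {disp' : measure_display} {T : measurableType disp'}
    {I : Type} (D : set I) (X : I -> Omega -> T) : set (set Omega) :=
  \bigcup_(i in D) preimage_set_system setT (X i) measurable.

Definition mutually_independent {disp' : measure_display}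
    {T : measurableType disp'} {I : choiceType} (D : set I)
    (X : I -> Omega -> T) : Prop :=
  forall (J : {fset I}) (B : I -> set T),
    [set` J] `<=` D -> (forall i, i \in J -> measurable (B i)) ->
    P (\bigcap_(i in [set` J]) (X i @^-1` B i)) =
    (\prod_(i <- J) P (X i @^-1` B i))%E.

Definition independent_systems (F G : set (set Omega)) : Prop :=
  forall A B, F A -> G B -> P (A `&` B) = (P A * P B)%E.

End Independence.

(* Undirected edges are the two-element sets of vertices; a family indexed by
   edges is indexed by {fset V}, and its values off [edges] are irrelevant. *)
Definition edges (V : choiceType) : set {fset V} := [set e | #|` e|%fset = 2%N].

Section ScaleFreePercolation.
Context {R : realType} {d : nat}.
Local Notation V := 'rV[int]_d.

(* Distinct lattice points are at distance at least 1, so for x != y the first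
   branch is exactly the case of nearest neighbours. *)
Definition connection_prob (alpha lambda : R) (w : V -> R) (x y : V) : R :=
  if enorm (x - y) <= 1 :> R then 1
  else 1 - expR (- (lambda * w x * w y / enorm (x - y) `^ alpha)).

(* [sfp_present] is the conditional law of the edges given the weights: for
   distinct edges e_1, ..., e_k, the product of their connection probabilities
   is a version of P(e_1, ..., e_k are all present | sigma(W)).
   Lengths are attached to all edges, present or not; being independent of the
   graph, the lengths of the present edges are then i.i.d. given the graph. *)
Record weighted_sfp (alpha lambda : R) (muW muL : probability R R)
    (disp : measure_display) (Omega : measurableType disp)
    (P : probability Omega R) (W : V -> {RV P >-> R})
    (present : {fset V} -> {RV P >-> bool}) (L : {fset V} -> {RV P >-> R}) :
    Prop := WeightedSFP {
  sfp_weight_law : forall x A, measurable A -> distribution P (W x) A = muW A;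
  sfp_weight_indep : mutually_independent P setT W;
  sfp_present : forall (s : seq (V * V)) (A : set Omega),
    all (fun p => p.1 != p.2) s -> uniq [seq [fset p.1; p.2]%fset | p <- s] ->
    <<s generated_by setT W >> A ->
    P (A `&` [set w | all (fun p => present [fset p.1; p.2]%fset w) s]) =
    (\int[P]_(w in A)
      (\prod_(p <- s) connection_prob alpha lambda (W ^~ w) p.1 p.2)%:E)%E;
  sfp_length_law : forall e A, edges e -> measurable A ->
    distribution P (L e) A = muL A;
  sfp_length_indep : mutually_independent P (@edges V) L;
  sfp_length_graph_indep : independent_systems P
    <<s generated_by (@edges V) L >>
    <<s generated_by setT W `|` generated_by (@edges V) present >>
}.

End ScaleFreePercolation.

Section Distances.
Context {R : realType} {V : choiceType}.

Definition adjacent (G : {fset V} -> bool) : rel V :=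
  fun x y => (x != y) && G [fset x; y]%fset.

(* Paths are self-avoiding and encoded by their list of vertices after x. *)
Definition is_path (G : {fset V} -> bool) (x y : V) (p : seq V) : bool :=
  [&& path (adjacent G) x p, uniq (x :: p) & last x p == y].

Definition path_edges (x : V) (p : seq V) : seq {fset V} :=
  pairmap (fun u v => [fset u; v]%fset) x p.

Definition graph_dist (G : {fset V} -> bool) (x y : V) : \bar R :=
  ereal_inf [set (size (path_edges x p))%:R%:E | p in is_path G x y].

Definition weighted_dist (G : {fset V} -> bool) (l : {fset V} -> R)
    (x y : V) : \bar R :=
  ereal_inf [set (\sum_(e <- path_edges x p) l e)%:E | p in is_path G x y].

Definition graph_ball (G : {fset V} -> bool) (x : V) (n : nat) : set V :=
  [set y | (graph_dist G x y <= n%:R%:E)%E].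

Definition weighted_ball (G : {fset V} -> bool) (l : {fset V} -> R)
    (x : V) (t : R) : set V :=
  [set y | (weighted_dist G l x y <= t%:E)%E].

End Distances.

(* Main.v *)
(** A first-moment bound on self-avoiding paths.  As [alpha > d] and
    [gamma > 2], there is an exponent [kappa] with [d / alpha < kappa < 1] and
    [2 kappa < tau - 1]; the connection probability of two vertices at distance
    [r] is at most [c (W_x W_y)^kappa r^(- alpha kappa)].  Along a self-avoiding
    path every vertex weight occurs at most twice, giving at most a factor
    [E W^(2 kappa)] per vertex, which is finite.  Give each present path the
    weight given by the product over its edges of [(2 r_e)^s] and of a function
    of the edge length dominating [exp (- theta L_e)], where
    [s < alpha kappa - d].  If [theta] is large, then the expected total weight
    [Z] of the paths from [x] is a convergent geometric series, hence [Z] is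
    almost surely finite.  A path from [x] to [y] of total length at most [t]
    then yields [|x - y|^s exp (- theta t) <= Z].  Taking all lengths equal to
    [1] gives the statement for the graph distance. *)

Require Import Defs.
From HB Require Import structures.
From mathcomp Require Import all_boot all_order all_algebra finmap.
From mathcomp Require Import all_classical all_reals all_analysis.
From mathcomp Require Import ring lra.
From mathcomp Require Import measurable_realfun.

Set Implicit Arguments.
Unset Strict Implicit.
Unset Printing Implicit Defensive.

Import Order.TTheory GRing.Theory Num.Theory.
Import numFieldNormedType.Exports.

Local Open Scope classical_set_scope.
Local Open Scope ring_scope.

(** * Product integrals of independent variables *)

(** Such series serve as majorants of functions of the weights and of the lengths: their
    expectations involve only probabilities of sets, so independence stated for events is enough. *)
Definition step_series {R : realType} (a : nat -> R) (B : nat -> set R) (t : R)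
    : \bar R := (\sum_(k <oo) (a k * \1_(B k) t)%:E)%E.

(** An infinite [c] has to be covered, since moments are not known to be finite when products are
    expanded. Both sides are then [+oo] as soon as some term is positive. *)
Lemma ge0_nneseriesZl {R : realType} (c : \bar R) (f : nat -> \bar R) :
  (0 <= c)%E -> (forall k, 0 <= f k)%E ->
  (\sum_(k <oo) (c * f k) = c * \sum_(k <oo) f k)%E.
Proof.
case: c => [r _ f_ge0|_ f_ge0|//]; first exact: nneseriesZl.
have [f0|] := pselect (forall k, f k = 0%E).
  by rewrite !eseries0 ?mule0 // => k _ _; rewrite f0 ?mule0.
move=> /existsNP[k /eqP fk0].
have fk_gt0 : (0 < f k)%E by rewrite lt0e fk0 f_ge0.
have -> : (\sum_(k <oo) (+oo * f k) = +oo)%E.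
  apply/eqP; rewrite -leye_eq -[leLHS](gt0_mulye fk_gt0).
  apply: le_trans
    (nneseries_lim_ge k.+1 (fun n _ _ => mule_ge0 (leey 0) (f_ge0 n))).
  by rewrite big_nat_recr //= leeDr // sume_ge0 // => n _; exact: mule_ge0.
rewrite gt0_mulye //; apply: lt_le_trans fk_gt0 _.
apply: le_trans (nneseries_lim_ge k.+1 (fun n _ _ => f_ge0 n)).
by rewrite big_nat_recr //= leeDr // sume_ge0.
Qed.

Section StepSeries.
Context {R : realType} (a : nat -> R) (B : nat -> set R).
Hypothesis a_ge0 : forall k, 0 <= a k.
Hypothesis B_meas : forall k, measurable (B k).

Lemma step_ge0 k t : (0 <= (a k * \1_(B k) t)%:E)%E.
Proof. by rewrite lee_fin mulr_ge0 // indicE. Qed.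

Lemma step_series_ge0 t : (0 <= step_series a B t)%E.
Proof. by apply: nneseries_ge0 => k _ _; exact: step_ge0. Qed.

Lemma measurable_step_series :
  measurable_fun [set: R] (step_series a B : R -> \bar R).
Proof.
apply: ge0_emeasurable_sum => k.
- by move=> t _ _; exact: step_ge0.
- move=> _; apply/measurable_EFinP; apply: measurable_funM => //.
Qed.

Lemma le_step_series k t : B k t -> ((a k)%:E <= step_series a B t)%E.
Proof.
move=> Bt; apply: le_trans (nneseries_lim_ge k.+1 (fun n _ _ => step_ge0 n t)).
rewrite big_nat_recr //= indicE mem_set // mulr1 leeDr //.
by apply: sume_ge0 => i _; exact: step_ge0.
Qed.

End StepSeries.

Lemma emeasurable_prod_ge0 {R : realType} d (T : measurableType d) (I : Type)
    (s : seq I) (f : I -> T -> \bar R) :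
  (forall i, measurable_fun setT (f i)) ->
  measurable_fun setT (fun w => \prod_(i <- s) f i w)%E.
Proof.
move=> mf; elim: s => [|i s IHs].
  by under eq_fun do rewrite big_nil; exact: measurable_cst.
by under eq_fun do rewrite big_cons; exact: emeasurable_funM.
Qed.

Section ProductIntegral.
Context {R : realType} {disp : measure_display} {Omega : measurableType disp}.
Variables (P : probability Omega R) (mu : probability R R).
Variables (a : nat -> R) (B : nat -> set R).
Hypothesis a_ge0 : forall k, 0 <= a k.
Hypothesis B_meas : forall k, measurable (B k).

(* Expanding the step series of a single variable and conditioning on that
   variable lying in [B k] leaves an event of the same kind, which drives the
   induction on the number of variables. *)
Lemma integral_prod_step_series (I : eqType) (X : I -> {RV P >-> R})
    (s : seq I) (C : set Omega) :
  uniq s -> measurable C ->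
  (forall D : I -> set R, (forall i, measurable (D i)) ->
    P (C `&` \bigcap_(i in [set` s]) (X i @^-1` D i)) =
    (P C * \prod_(i <- s) mu (D i))%E) ->
  (\int[P]_w ((\1_C w)%:E * \prod_(i <- s) step_series a B (X i w)) =
   P C * (\sum_(k <oo) (a k)%:E * mu (B k)) ^+ size s)%E.
Proof.
elim: s C => [|i s IHs] C.
  move=> _ mC _; rewrite mule1.
  under eq_integral do rewrite big_nil mule1.
  by rewrite integral_indic // setIT.
rewrite cons_uniq => /andP[iNs us] mC indep.
pose g w := (\prod_(j <- s) step_series a B (X j w))%E.
have g_ge0 w : (0 <= g w)%E.
  by rewrite /g; elim: (s) => [|j r IHr];
     rewrite ?big_nil ?big_cons // mule_ge0 // step_series_ge0.
have mg : measurable_fun setT g.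
  apply: emeasurable_prod_ge0 => j.
  by apply: measurableT_comp => //; exact: measurable_step_series.
have mX k : measurable (X i @^-1` B k).
  by rewrite -[_ @^-1` _]setTI; exact: measurable_funP.
have split_series w : ((\1_C w)%:E * \prod_(j <- i :: s) step_series a B (X j w) =
    \sum_(k <oo) ((a k)%:E * ((\1_(C `&` X i @^-1` B k) w)%:E * g w)))%E.
  rewrite big_cons -/(g w) muleCA /step_series.
  have [Cw|NCw] := boolP (w \in C); last first.
    rewrite indicE (negbTE NCw) mul0e mule0 eseries0 // => k _ _.
    by rewrite (indicE _ (_ `&` _)) in_setI (negbTE NCw) mul0e mule0.
  rewrite indicE Cw mul1e muleC.
  rewrite -ge0_nneseriesZl //; last by move=> k; exact: step_ge0.
  apply: eq_eseriesr => k _.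
  rewrite (indicE _ (_ `&` _)) in_setI Cw muleC EFinM muleA indicE.
  by congr (_ * (_ %:R)%:E * _)%E; apply/idP/idP; rewrite !inE.
under eq_integral do rewrite split_series.
have mC' k : measurable (C `&` X i @^-1` B k) by exact: measurableI.
have mCg k : measurable_fun setT
    (fun w => ((\1_(C `&` X i @^-1` B k) w)%:E * g w))%E.
  by apply: emeasurable_funM => //; exact/measurable_EFinP.
have Cg_ge0 k w : (0 <= (\1_(C `&` X i @^-1` B k) w)%:E * g w)%E.
  by rewrite mule_ge0 // lee_fin indicE.
rewrite integral_nneseries //; last first.
- by move=> k w _; rewrite mule_ge0 // lee_fin.
- by move=> k; exact: emeasurable_funM.
(* As [i] does not occur in [s], [A] can be prescribed at [i] without touching [D] on [s]; [indep]
   then applies to [C] cut by one event of [X i]. *)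
have prodD (D : I -> set R) (A : set R) :
    (\prod_(j <- s) mu (if j == i then A else D j) = \prod_(j <- s) mu (D j))%E.
  apply: eq_big_seq => j js; case: eqP => // ji.
  by rewrite -ji js in iNs.
have capD (D : I -> set R) (A : set R) :
    \bigcap_(j in [set` i :: s]) (X j @^-1` (if j == i then A else D j)) =
    (X i @^-1` A) `&` \bigcap_(j in [set` s]) (X j @^-1` D j).
  apply/seteqP; split=> w /=.
    move=> h; split=> [|j /= js].
      by have := h i; rewrite /= mem_head eqxx; apply.
    have := h j; rewrite /= inE js orbT; case: eqP => [ji|_]; last by apply.
    by rewrite -ji js in iNs.
  move=> [hi hs] j /=; rewrite inE; case: eqP => [-> _ //|_ /= js].
  exact: hs.
have indepC k (D : I -> set R) : (forall j, measurable (D j)) ->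
    P ((C `&` X i @^-1` B k) `&` \bigcap_(j in [set` s]) (X j @^-1` D j)) =
    (P C * (mu (B k) * \prod_(j <- s) mu (D j)))%E.
  move=> mD; rewrite -setIA -capD indep.
    by rewrite big_cons eqxx prodD.
  by move=> j; case: ifP.
(* Taking every [D j] to be the whole line gives the probability of the cut event, which puts
   [indepC] in the form the induction hypothesis needs. *)
have PC k : P (C `&` X i @^-1` B k) = (P C * mu (B k))%E.
  have := indepC k (fun=> setT) (fun=> measurableT).
  rewrite (_ : \bigcap_(_ in _) _ = setT); last first.
    by apply/seteqP; split.
  rewrite setIT => ->; rewrite big1_seq ?mule1 // => j _; exact: probability_setT.
under eq_eseriesr => k _.
  rewrite ge0_integralZl_EFin // IHs //; last first.
    by move=> D mD; rewrite indepC // PC muleA.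
  rewrite PC; over.
have muB_ge0 k : (0 <= (a k)%:E * mu (B k))%E by rewrite mule_ge0 // lee_fin.
set Q := (_ ^+ size s)%E.
have Q_ge0 : (0 <= Q)%E by apply: expe_ge0; exact: nneseries_ge0.
under eq_eseriesr => k _ do rewrite -muleA muleCA (muleA (a k)%:E) muleC.
rewrite ge0_nneseriesZl //.
  by rewrite expeS -/Q muleAC muleA.
by rewrite mule_ge0.
Qed.

End ProductIntegral.

(** * Sums over sequences and over the integers *)

Lemma powR_lt1 {R : realType} (x y : R) : 1 < x -> y < 0 -> x `^ y < 1.
Proof.
move=> x_gt1 y_lt0; rewrite /powR gt_eqF ?(lt_trans ltr01) //.
by rewrite expR_lt1 nmulr_rlt0 // ln_gt0.
Qed.

Lemma powRN_antitone {R : realType} (b x y : R) :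
  0 <= b -> 0 < x -> x <= y -> y `^ (- b) <= x `^ (- b).
Proof.
move=> b_ge0 x_gt0 xy; have y_gt0 := lt_le_trans x_gt0 xy.
rewrite !powRN lef_pV2 ?posrE ?powR_gt0 //.
by apply: ge0_ler_powR; rewrite ?nnegrE ?(ltW x_gt0) ?(ltW y_gt0).
Qed.

Lemma nneseries_le_ub {R : realType} (u : nat -> \bar R) (M : \bar R) :
  (forall k, 0 <= u k)%E -> (forall n, \sum_(0 <= k < n) u k <= M)%E ->
  (\sum_(k <oo) u k <= M)%E.
Proof.
move=> u_ge0 leM; apply: lime_le; last by apply: nearW => n; exact: leM.
by apply: is_cvg_nneseries => k _ _; exact: u_ge0.
Qed.

Lemma nneseries_geometric_fin {R : realType} (u : nat -> \bar R) (M r : R) :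
  0 <= M -> 0 < r < 1 -> (forall k, 0 <= u k <= (M * r ^+ k)%:E)%E ->
  (\sum_(k <oo) u k < +oo)%E.
Proof.
move=> M_ge0 /andP[r_gt0 r_lt1] u_le.
apply: (@le_lt_trans _ _ (M * (1 - r)^-1)%:E); last exact: ltry.
apply: nneseries_le_ub => [k|n]; first by case/andP: (u_le k).
apply: (@le_trans _ _ (\sum_(0 <= k < n) (M * r ^+ k)%:E)%E).
  by apply: lee_sum => k _; case/andP: (u_le k).
rewrite sumEFin lee_fin; have := @geometric_le_lim R n M r M_ge0 r_gt0.
by apply; rewrite gtr0_norm.
Qed.

Lemma esumZl_le {R : realType} (T : choiceType) (S : set T) (c : \bar R)
    (f : T -> \bar R) :
  (0 <= c)%E -> (forall i, 0 <= f i)%E ->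
  (\esum_(i in S) (c * f i) <= c * \esum_(i in S) f i)%E.
Proof.
move=> c_ge0 f_ge0; apply: ge_ereal_sup => _ [X [finX XS] <-].
rewrite -ge0_mule_fsumr; last by move=> i; rewrite f_ge0.
by apply: lee_wpmul2l => //; apply: esum_ge; exists X.
Qed.

(** Split off the first vertex: the sum over the remaining ones is at most [F ^+ n] whatever that
    vertex is, and the sum over the first step contributes one more factor [F]. *)
Lemma esum_size_le {R : realType} (T : choiceType) (f : T -> T -> \bar R)
    (F : \bar R) :
  (forall x y, 0 <= f x y)%E -> (forall x, \esum_(y in setT) f x y <= F)%E ->
  forall n x,
  (\esum_(p in [set p | size p = n]) \prod_(e <- pairmap f x p) e <= F ^+ n)%E.
Proof.
move=> f_ge0 leF n; have prod_ge0 x p : (0 <= \prod_(e <- pairmap f x p) e)%E.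
  by elim: p x => [|y p IHp] x; rewrite /= ?big_nil ?big_cons // mule_ge0.
elim: n => [|n IHn] x.
  rewrite (_ : [set p | _] = [set [::]]); last first.
    by apply/seteqP; split=> [p /= /size0nil|p /= ->].
  by rewrite esum_set1 /= big_nil.
have F_ge0 : (0 <= F)%E by apply: le_trans (leF x); apply: esum_ge0.
rewrite (@reindex_esum _ _ _
  (setT `*`` (fun=> [set p : seq T | size p = n])) _ (fun yp => yp.1 :: yp.2));
  last first.
  split.
  - by move=> [y p] /= [_ ->].
  - by move=> [y p] [y' p'] _ _ /= [-> ->].
  - by move=> [//|y p] /= [sp]; exists (y, p).
under eq_esum do rewrite /= big_cons.
rewrite -(@esum_esum _ _ _ setT (fun=> [set p : seq T | size p = n])
  (fun y p => f x y * \prod_(e <- pairmap f y p) e)%E); last first.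
  by move=> *; rewrite mule_ge0.
apply: (@le_trans _ _ (\esum_(y in setT) (F ^+ n * f x y))%E).
  apply: le_esum => y _; apply: le_trans (esumZl_le _ _ _) _ => //.
  by rewrite muleC lee_wpmul2r.
apply: le_trans (esumZl_le _ _ _) _ => //; first exact: expe_ge0.
by rewrite expeS muleC lee_wpmul2r // expe_ge0.
Qed.

Lemma esum_seq_le {R : realType} (T : choiceType) (f : T -> T -> \bar R)
    (F : \bar R) :
  (forall x y, 0 <= f x y)%E -> (forall x, \esum_(y in setT) f x y <= F)%E ->
  forall x, (\esum_(p in setT) \prod_(e <- pairmap f x p) e
             <= \sum_(n <oo) F ^+ n)%E.
Proof.
move=> f_ge0 leF x.
have prod_ge0 p : (0 <= \prod_(e <- pairmap f x p) e)%E.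
  by elim: p x => [|y p IHp] x; rewrite /= ?big_nil ?big_cons // mule_ge0.
rewrite (_ : setT = \bigcup_n [set p : seq T | size p = n]); last first.
  by apply/seteqP; split=> // p _; exists (size p).
rewrite nneseries_sum_bigcup //; last first.
  by move=> i j _ _ [p [/= <- <-]].
apply: lee_nneseries => n _; first by move=> _; exact: esum_ge0.
exact: esum_size_le.
Qed.

(** Cauchy condensation: the block [2 ^ j <= k < 2 ^ j.+1] contributes at most [r ^+ j] with
    [r = 2 ^ (1 - b) < 1]. The index 0 gets the value 1, as needed for zero coordinates of lattice
    vectors. *)
Lemma nneseries_powR_fin {R : realType} (b : R) : 1 < b ->
  (\sum_(k <oo) ((maxn 1 k)%:R `^ (- b) : R)%:E < +oo)%E.
Proof.
move=> b_gt1; pose u k : R := (maxn 1 k)%:R `^ (- b).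
pose r : R := 2 `^ (1 - b).
have r_gt0 : 0 < r by rewrite powR_gt0.
have r_lt1 : r < 1.
  by apply: powR_lt1; [rewrite ltr1n|rewrite subr_lt0].
have u_ge0 k : 0 <= u k by exact: powR_ge0.
have u_le m n : (m <= n)%N -> u n <= u m.
  move=> mn; apply: powRN_antitone; rewrite ?ltr0n ?leq_max // ?ler_nat.
    by lra.
  by rewrite geq_max leq_maxl /= leq_max mn orbT.
have dyadic j : \sum_(0 <= k < 2 ^ j) u k <= 1 + \sum_(0 <= i < j) r ^+ i.
  elim: j => [|j IHj].
    by rewrite expn0 big_nat1 big_geq // addr0 /u maxn0 powR1.
  rewrite (@big_cat_nat _ _ _ (2 ^ j)) //=; last by rewrite leq_exp2l.
  rewrite [in leRHS]big_nat_recr //= addrA lerD //.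
  apply: (@le_trans _ _ (\sum_(2 ^ j <= k < 2 ^ j.+1) u (2 ^ j)%N)).
    by apply: ler_sum_nat => k /andP[jk _]; exact: u_le.
  rewrite sumr_const_nat expnS mul2n -addnn addnK /u (maxn_idPr _) ?expn_gt0 //.
  rewrite -[leLHS]mulr_natl; set x : R := (2 ^ j)%:R.
  have x_gt0 : 0 < x by rewrite ltr0n expn_gt0.
  rewrite -[X in X * _](powRr1 (ltW x_gt0)) -powRD;
    last by rewrite (gt_eqF x_gt0) implybT.
  rewrite /x natrX -(powR_mulrn _ (ler0n _ 2)) -(powR_mulrn _ (powR_ge0 _ _)).
  by rewrite /r -!powRrM mulrC.
apply: (@le_lt_trans _ _ (1 + (1 - r)^-1)%:E); last exact: ltry.
apply: nneseries_le_ub => [k|n]; first by rewrite lee_fin.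
rewrite sumEFin lee_fin; apply: (@le_trans _ _ (\sum_(0 <= k < 2 ^ n) u k)).
  rewrite [leRHS](@big_cat_nat _ _ _ n) //=; last by rewrite ltnW // ltn_expl.
  by rewrite lerDl sumr_ge0.
apply: le_trans (dyadic n) _; rewrite lerD2l.
have := @geometric_le_lim R n 1 r ler01 r_gt0.
rewrite mul1r gtr0_norm // => /(_ r_lt1); apply: le_trans.
by rewrite /series /=; apply: ler_sum => i _; rewrite mul1r.
Qed.

Lemma esum_int_powR_fin {R : realType} (b : R) : 1 < b ->
  (\esum_(k in [set: int]) ((maxn 1 `|k|%N)%:R `^ (- b) : R)%:E < +oo)%E.
Proof.
move=> b_gt1; have u_fin := nneseries_powR_fin b_gt1.
rewrite (esumID (range Posz)); last by move=> k _; rewrite lee_fin powR_ge0.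
rewrite setTI (_ : setT `&` _ = range Negz); last first.
  apply/seteqP; split=> [[k|k] [_ /= Nk]|_ [k _ <-]].
  - by case: Nk; exists k.
  - by exists k.
  - by split=> // -[].
rewrite !esum_image; [|by move=> ? ? _ _ []..].
rewrite /= -!nneseries_esumT; [|by move=> k; rewrite lee_fin powR_ge0..].
rewrite lte_add_pinfty //; apply: le_lt_trans u_fin.
apply: lee_nneseries => k _; rewrite lee_fin ?powR_ge0 //.
apply: powRN_antitone; rewrite ?ltr0n ?leq_max // ?ler_nat; first by lra.
by rewrite geq_max leq_maxl /= leq_max leqnSn orbT.
Qed.

(** * Lattice norms and displacements *)

Section LatticeNorm.
Context {R : realType} {d : nat}.
Local Notation V := 'rV[int]_d.

Lemma enorm_ge0 (v : V) : 0 <= enorm v :> R.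
Proof. exact: sqrtr_ge0. Qed.

Lemma enorm0 : enorm (0 : V) = 0 :> R.
Proof.
by rewrite /enorm big1 ?sqrtr0 // => i _; rewrite mxE expr0n.
Qed.

Lemma enorm_sqr (v : V) : (enorm v) ^+ 2 = \sum_(i < d) ((v 0 i)%:~R : R) ^+ 2.
Proof. by rewrite sqr_sqrtr // sumr_ge0 // => i _; exact: sqr_ge0. Qed.

Lemma coord_le_enorm (v : V) i : (absz (v 0 i))%:R <= enorm v :> R.
Proof.
rewrite -(@ler_pXn2r _ 2) ?nnegrE ?ler0n ?enorm_ge0 // enorm_sqr.
rewrite (bigD1 i) //= natr_absz intr_norm real_normK ?num_real //.
by rewrite lerDl sumr_ge0 // => j _; exact: sqr_ge0.
Qed.

Lemma enorm_ge1 (v : V) : v != 0 -> 1 <= enorm v :> R.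
Proof.
move=> v_neq0; have [i vi] : exists i, v 0 i != 0.
  apply/existsP; apply: contraR v_neq0 => /existsPn v0.
  by apply/eqP/rowP => i; rewrite mxE; apply/eqP; rewrite -[_ == _]negbK v0.
by apply: le_trans (coord_le_enorm v i); rewrite ler1n absz_gt0.
Qed.

(* Two reals [a, b >= 1] satisfy [a + b <= 2 a b]: on a lattice this lets a
   product of step lengths bound the displacement, with no triangle
   inequality. *)
Lemma enormD_le (u v : V) (a b : R) : 1 <= a -> 1 <= b ->
  enorm u <= a -> enorm v <= b -> enorm (u + v) <= 2 * a * b.
Proof.
move=> a_ge1 b_ge1 ua vb.
rewrite -(@ler_pXn2r _ 2) ?nnegrE ?enorm_ge0 //; last by nra.
have ua2 : enorm u ^+ 2 <= a ^+ 2 by rewrite lerXn2r ?nnegrE ?enorm_ge0 //; lra.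
have vb2 : enorm v ^+ 2 <= b ^+ 2 by rewrite lerXn2r ?nnegrE ?enorm_ge0 //; lra.
apply: (@le_trans _ _ (2 * (enorm u ^+ 2 + enorm v ^+ 2))); last first.
  have a2 : 1 <= a ^+ 2 by rewrite exprn_ege1.
  have b2 : 1 <= b ^+ 2 by rewrite exprn_ege1.
  by rewrite !exprMn; nra.
rewrite !enorm_sqr -big_split mulr_sumr /=; apply: ler_sum => i _.
rewrite mxE intrD; set s : R := (u 0 i)%:~R; set t : R := (v 0 i)%:~R.
have := sqr_ge0 (s - t); nra.
Qed.

(** Every step of a self-avoiding path has length at least 1, so [enormD_le] applies at each vertex.
    The maximum with 1 supplies the lower bound asked of the tail and settles the empty path. *)
Lemma enorm_last_le (x : V) (p : seq V) : uniq (x :: p) ->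
  Num.max 1 (enorm (x - last x p))
    <= \prod_(c <- pairmap (fun u v => 2 * enorm (u - v)) x p) c :> R.
Proof.
elim: p x => [|y p IHp] x.
  by rewrite /= subrr enorm0 big_nil ge_max lexx ler01.
rewrite cons_uniq => /andP[xNp up]; rewrite /= big_cons.
have := IHp y up; set Q := \prod_(_ <- _) _; rewrite ge_max => /andP[Q_ge1 leQ].
have r_ge1 : 1 <= enorm (x - y) :> R.
  apply: enorm_ge1; rewrite subr_eq0.
  by apply: contraNneq xNp => ->; rewrite mem_head.
rewrite ge_max; apply/andP; split; first by nra.
by rewrite -(subrKA y) enormD_le.
Qed.

(** Off the origin, [|v|^(-b)] is at most the product over the coordinates of
    [max(1, |v_i|)^(-b/d)]. As [b/d > 1], the sum of these products is controlled by [d] convergent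
    sums over the integers. *)
Lemma esum_enorm_fin (b : R) : (0 < d)%N -> d%:R < b ->
  (\esum_(v in [set: V]) (enorm v `^ (- b))%:E < +oo)%E.
Proof.
move=> d_gt0 b_gt; have dR_gt0 : 0 < d%:R :> R by rewrite ltr0n.
pose c := b / d%:R; have c_gt1 : 1 < c by rewrite ltr_pdivlMr // mul1r.
pose u (k : int) : \bar R := ((maxn 1 `|k|%N)%:R `^ (- c))%:E.
have u_ge0 k : (0 <= u k)%E by rewrite lee_fin powR_ge0.
pose coords (v : V) := [seq v 0 i | i <- enum 'I_d].
have coords_inj : injective coords.
  move=> v w /eq_in_map vw; apply/rowP => i; apply: vw.
  by rewrite mem_enum.
have le_u v : ((enorm v `^ (- b))%:E <= \prod_(k <- coords v) u k)%E.
  rewrite big_map big_enum /= /u prodEFin lee_fin.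
  (* [powR] sends 0 to 0 for a nonzero exponent, so the origin contributes nothing. *)
  have [->|v_neq0] := eqVneq v 0.
    rewrite enorm0 powR0 ?prodr_ge0 // oppr_eq0 gt_eqF //.
    exact: lt_trans b_gt.
  have r_ge1 := enorm_ge1 v_neq0.
  rewrite [leLHS](_ : _ = \prod_(i < d) enorm v `^ (- c)).
    apply: ler_prod => i _; rewrite powR_ge0 /=.
    apply: powRN_antitone; first by rewrite ltW // (lt_trans ltr01).
      by rewrite ltr0n leq_max.
    by case: leqP => _ //; exact: coord_le_enorm.
  rewrite prodr_const card_ord -powR_mulrn ?powR_ge0 // -powRrM.
  by rewrite /c -mulNr mulfVK // gt_eqF.
apply: (@le_lt_trans _ _ ((\esum_(k in [set: int]) u k) ^+ d)%E); last first.
  have : (\esum_(k in [set: int]) u k < +oo)%E by exact: esum_int_powR_fin.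
  have : (0 <= \esum_(k in [set: int]) u k)%E by exact: esum_ge0.
  case: (esum _ _) => // r _ _.
  by rewrite -EFin_expe ltry.
apply: (@le_trans _ _ (\esum_(v in [set: V]) \prod_(k <- coords v) u k)%E).
  exact: le_esum.
rewrite -(@esum_image _ _ _ setT coords (fun q => \prod_(k <- q) u k)%E);
  last by move=> v w _ _; exact: coords_inj.
(* A vector is read as the sequence of its [d] coordinates; the kernel ignores the previous entry,
   so the starting point 0 is arbitrary. *)
apply: le_trans (@esum_size_le _ _ (fun=> u) _ _ _ d 0) => //.
have -> : (fun p : seq int => \prod_(e <- pairmap (fun=> u) (0%R : int) p) e)%E =
          (fun p => \prod_(k <- p) u k)%E.
  apply/funext => p; rewrite -[RHS](big_map u xpredT id); congr bigop.
  by elim: p (0 : int) => //= k p IHp m; rewrite IHp.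
apply: le_ereal_sup => _ [X [finX XS] <-]; exists X => //; split=> //.
apply: subset_trans XS _ => _ [v _ <-] /=.
by rewrite size_map size_enum_ord.
Qed.

End LatticeNorm.

(** * Weights and connection probabilities *)

(** Ratio test from the index [N] on, by induction on [N]: dropping the first term shifts the
    geometric bound, and the constant [u 0 + M / r] makes up for both. *)
Lemma ratio_bound {R : realType} (u : nat -> R) (r : R) (N : nat) :
  0 < r -> (forall k, 0 <= u k) ->
  (forall k, (N <= k)%N -> u k.+1 <= r * u k) ->
  exists2 M, 0 <= M & forall k, u k <= M * r ^+ k.
Proof.
move=> r_gt0; elim: N u => [|N IHN] u u_ge0 ratio.
  exists (u 0%N) => // k; elim: k => [|k IHk]; first by rewrite mulr1.
  apply: le_trans (ratio k _) _ => //.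
  by rewrite exprS mulrCA ler_pM2l.
have [k|k Nk|M M_ge0 leM] := IHN (u \o succn).
- exact: u_ge0.
- exact: ratio.
exists (u 0%N + M / r); first by rewrite addr_ge0 ?divr_ge0 // ltW.
move=> [|k]; first by rewrite mulr1 lerDl divr_ge0 // ltW.
apply: le_trans (leM k) _; rewrite exprS mulrA mulrDl divfK ?gt_eqF //.
by rewrite ler_pM2r ?exprn_gt0 // lerDr mulr_ge0 // ltW.
Qed.

Section DyadicWeights.
Context {R : realType}.

(** The value of [w ^ (2 kappa)] at [w = 2 ^ (k + 1)], the upper end of the [k]-th dyadic block. *)
Definition dyadic_coef (kappa : R) (k : nat) : R := (2 `^ (2 * kappa)) ^+ k.+1.

(** Tails rather than blocks, because the law of the weights is given through its tails; the index 0
    takes care of weights up to 2. *)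
Definition dyadic_tail (k : nat) : set R :=
  if k is 0%N then setT else `]2 ^+ k, +oo[%classic.

Lemma dyadic_coef_ge0 kappa k : 0 <= dyadic_coef kappa k.
Proof. by rewrite exprn_ge0 // powR_ge0. Qed.

Lemma measurable_dyadic_tail k : measurable (dyadic_tail k).
Proof. by case: k => [|k]; [exact: measurableT | exact: measurable_itv]. Qed.

Lemma powR_le_step_series (kappa w : R) : 0 <= kappa -> 1 <= w ->
  ((w `^ (2 * kappa))%:E
    <= step_series (dyadic_coef kappa) dyadic_tail w)%E.
Proof.
move=> kappa_ge0 w_ge1.
have ex_dyadic : exists j, w <= 2 ^+ j.
  exists (Num.truncn w).+1; rewrite -natrX.
  apply: le_trans (ltW (truncnS_gt _)) _.
  by rewrite ler_nat ltnW // ltn_expl.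
have [k [wk kw]] : exists k, dyadic_tail k w /\ w <= 2 ^+ k.+1.
  (* With [j] the least exponent such that [w <= 2 ^ j], the index is [j - 1], or 0 when [j = 0]. *)
  case: (ex_minnP ex_dyadic) => -[|[|k]] wj j_min.
  - by exists 0%N; split=> //; rewrite (le_trans wj) // expr0 expr1 ler1n.
  - by exists 0%N.
  - exists k.+1; split=> //; rewrite /= in_itv /= andbT ltNge.
    by apply/negP => /j_min; rewrite ltnn.
apply: le_trans (le_step_series (dyadic_coef_ge0 kappa) wk).
rewrite lee_fin /dyadic_coef -powR_mulrn ?powR_ge0 // powRAC powR_mulrn //.
by apply: ge0_ler_powR; rewrite ?nnegrE ?mulr_ge0 ?exprn_ge0 // (le_trans ler01).
Qed.

(** By slow variation at the single factor 2, the ratio of consecutive terms tends to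
    [rho = 2 ^ (2 kappa - (tau - 1)) < 1]; from some index on it is at most the midpoint [r] of
    [rho] and 1. *)
Lemma dyadic_moment_fin (mu : probability R R) (ell : R -> R) (tau kappa : R) :
  slowly_varying ell ->
  (forall t : R, 0 < t -> mu `]t, +oo[%classic = (ell t / t `^ (tau - 1))%:E) ->
  2 * kappa < tau - 1 ->
  (\sum_(k <oo) (dyadic_coef kappa k)%:E * mu (dyadic_tail k) < +oo)%E.
Proof.
move=> [_ ell_gt0 ell_ratio] tail kappa_lt.
pose A : R := 2 `^ (2 * kappa); pose rho : R := 2 `^ (2 * kappa - (tau - 1)).
have A_gt0 : 0 < A by exact: powR_gt0.
have rho_gt0 : 0 < rho by exact: powR_gt0.
have rho_lt1 : rho < 1 by apply: powR_lt1; [rewrite ltr1n|rewrite subr_lt0].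
pose r := (1 + rho) / 2.
have r_gt0 : 0 < r by rewrite /r; lra.
have r_lt1 : r < 1 by rewrite /r; lra.
have rho_lt : 1 < r / rho by rewrite ltr_pdivlMr // mul1r /r; lra.
pose u k : R := A ^+ k.+1 * fine (mu (dyadic_tail k)).
have u_ge0 k : 0 <= u k by rewrite mulr_ge0 ?exprn_ge0 ?(ltW A_gt0) ?fine_ge0.
have [T [Treal ell_T]] : \forall t \near +oo,
    0 < ell t /\ ell (2 * t) / ell t < r / rho.
  near=> t; split; first by near: t.
  near: t; have := ell_ratio 2 (ltr0Sn _ 1).
  move=> /cvgrPdist_lt/(_ (r / rho - 1)); rewrite subr_gt0 => /(_ rho_lt).
  apply: filterS => t; rewrite distrC => /(le_lt_trans (ler_norm _)).
  by rewrite ltrD2r.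
have pow_gt0 k : 0 < 2 ^+ k :> R by exact: exprn_gt0.
have [|M M_ge0 leM] := @ratio_bound _ u r (Num.truncn T).+1 r_gt0 u_ge0.
  move=> k Nk; have Tk : T < 2 ^+ k.
    apply: lt_le_trans (truncnS_gt _) _.
    by rewrite -natrX ler_nat (leq_trans Nk) // ltnW // ltn_expl.
  have [ell_k ratio_k] := ell_T _ Tk.
  (* The index 0, where the set is the whole line and [tail] does not apply, lies below the
     threshold. *)
  case: k Nk Tk ell_k ratio_k => // k _ _ ell_k.
  rewrite /u /dyadic_tail !tail //= ltr_pdivrMr // -exprS => ratio_k.
  set e0 := ell (2 ^+ k.+1) in ell_k ratio_k *.
  set e1 := ell (2 ^+ k.+2) in ratio_k *.
  have -> : (2 ^+ k.+2 : R) `^ (tau - 1) = (2 ^+ k.+1) `^ (tau - 1) * (A / rho).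
    rewrite exprS powRM ?exprn_ge0 // mulrC /A /rho -powRB ?pnatr_eq0 ?implybT //.
    by congr (_ * 2 `^ _); ring.
  have : 0 < (2 ^+ k.+1 : R) `^ (tau - 1) by exact: powR_gt0.
  set z := _ `^ _ => z_gt0.
  have -> : A ^+ k.+3 * (e1 / (z * (A / rho))) = A ^+ k.+2 * rho / z * e1.
    by rewrite [A ^+ k.+3]exprS; field; rewrite !gt_eqF.
  have -> : r * (A ^+ k.+2 * (e0 / z)) = A ^+ k.+2 * rho / z * (r / rho * e0).
    by field; rewrite !gt_eqF.
  apply: ler_wpM2l; last exact: ltW.
  by apply: divr_ge0 (ltW z_gt0); apply: mulr_ge0 (ltW rho_gt0);
     apply: exprn_ge0; apply: ltW.
apply: (nneseries_geometric_fin M_ge0 (r := r)); first by rewrite r_gt0.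
move=> k; apply/andP; split; first by rewrite mule_ge0 ?lee_fin ?dyadic_coef_ge0.
apply: le_trans (_ : (u k)%:E <= _)%E; last by rewrite lee_fin.
rewrite /u EFinM fineK ?fin_num_measure //; exact: measurable_dyadic_tail.
Unshelve. all: by end_near. Qed.

End DyadicWeights.

Section ConnectionProbability.
Context {R : realType} {d : nat}.
Local Notation V := 'rV[int]_d.

(** For [t >= 0] and [0 <= kappa <= 1], [1 - exp (- t) <= min 1 t <= t ^ kappa]. The maximum with 1
    keeps the bound at least 1 for nearest neighbours, whose edge is always present. *)
Lemma connection_prob_bounds (alpha lambda kappa : R) (w : V -> R) (x y : V) :
  0 <= lambda -> 0 <= kappa <= 1 -> 1 <= w x -> 1 <= w y -> x != y ->
  0 <= connection_prob alpha lambda w x y <=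
    Num.max 1 lambda `^ kappa * enorm (x - y) `^ (- (alpha * kappa)) *
    (w x `^ kappa * w y `^ kappa).
Proof.
move=> lambda_ge0 /andP[kappa_ge0 kappa_le1] wx wy xy.
have r_ge1 : 1 <= enorm (x - y) :> R by apply: enorm_ge1; rewrite subr_eq0.
have wx_ge0 : 0 <= w x by lra.
have wy_ge0 : 0 <= w y by lra.
have L_ge1 : 1 <= Num.max 1 lambda by rewrite le_max lexx.
have L_ge : lambda <= Num.max 1 lambda by rewrite le_max lexx orbT.
set L := Num.max 1 lambda in L_ge1 L_ge *.
rewrite /connection_prob; set r : R := enorm (x - y) in r_ge1 *.
have ra_gt0 : 0 < r `^ alpha by rewrite powR_gt0 // (lt_le_trans ltr01).
have wL : lambda * w x * w y <= L * w x * w y.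
  by rewrite !ler_wpM2r.
have -> : L `^ kappa * r `^ (- (alpha * kappa)) * (w x `^ kappa * w y `^ kappa)
    = (L * w x * w y / r `^ alpha) `^ kappa.
  have L_ge0 : 0 <= L by lra.
  have -> : r `^ (- (alpha * kappa)) = (r `^ alpha)^-1 `^ kappa.
    by rewrite -powR_inv1 ?powR_ge0 // -!powRrM; congr (_ `^ _); ring.
  rewrite powRM ?invr_ge0 ?(ltW ra_gt0) ?mulr_ge0 // !powRM ?mulr_ge0 //.
  by ring.
have ww_ge1 : 1 <= L * w x * w y by rewrite !mulr_ege1.
case: ifPn => [r_le1|_].
  rewrite ler01 /= (_ : r = 1) ?powR1 ?divr1;
    last by apply/eqP; rewrite eq_le r_le1.
  by rewrite -[leLHS](powRr0 (L * w x * w y)) ler_powR.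
set t := lambda * w x * w y / r `^ alpha.
have t_ge0 : 0 <= t by rewrite divr_ge0 ?mulr_ge0 // ltW.
have exp_le1 : expR (- t) <= 1 by rewrite expR_le1 oppr_le0.
rewrite subr_ge0 exp_le1 /=; set s := L * w x * w y / r `^ alpha.
have ts : t <= s by rewrite ler_wpM2r // invr_ge0 ltW.
have [s_ge1|s_lt1] := leP 1 s.
  apply: (@le_trans _ _ 1); first by rewrite gerBl expR_ge0.
  by rewrite -[leLHS](powRr0 s) ler_powR.
apply: (@le_trans _ _ s).
  apply: le_trans ts; have := expR_ge1Dx (- t); lra.
have s_gt0 : 0 < s by rewrite divr_gt0 // (lt_le_trans ltr01).
by rewrite ger1_powR // s_gt0 ltW.
Qed.

(** Every vertex lies on at most two edges of the path, and the factors missing at the two ends are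
    at least 1. *)
Lemma prod_pairmap_le_prod_sqr (T : Type) (a : T -> R) (x : T) (p : seq T) :
  (forall v, 1 <= a v) ->
  \prod_(c <- pairmap (fun u v => a u * a v) x p) c
    <= \prod_(v <- x :: p) a v ^+ 2.
Proof.
(* The extra factor supplies the second occurrence of the starting vertex, which makes the induction
   go through. *)
move=> a_ge1; suff h : a x * \prod_(c <- pairmap (fun u v => a u * a v) x p) c
    <= \prod_(v <- x :: p) a v ^+ 2.
  apply: le_trans h; rewrite ler_peMl //; elim: p x => [|y p IHp] x /=.
    by rewrite big_nil.
  have := a_ge1 x; have := a_ge1 y; have := IHp y.
  by rewrite big_cons => *; rewrite !mulr_ge0 //; lra.
elim: p x => [|y p IHp] x; rewrite /= big_cons.
  by rewrite !big_nil !mulr1; have := a_ge1 x; nra.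
rewrite [X in _ <= X]big_cons.
rewrite (_ : _ * _ = a x ^+ 2 *
  (a y * \prod_(c <- pairmap (fun u v => a u * a v) y p) c)); last by ring.
by rewrite ler_wpM2l ?sqr_ge0.
Qed.

End ConnectionProbability.

(** * Expected path weights *)

Lemma map_pairmap (T S U : Type) (f : S -> U) (g : T -> T -> S) (x : T)
    (p : seq T) :
  map f (pairmap g x p) = pairmap (fun u v => f (g u v)) x p.
Proof. by elim: p x => //= y p IHp x; rewrite IHp. Qed.

Section PathEdges.
Context {V : choiceType}.
Implicit Types (x : V) (p : seq V).

Lemma path_edges_sub x p e : e \in path_edges x p -> {subset e <= x :: p}.
Proof.
elim: p x => [//|y p IHp] x; rewrite /= inE => /orP[/eqP ->|/IHp ep] v.
  by rewrite !inE => /orP[] ->; rewrite ?orbT.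
by move=> /ep vp; rewrite inE vp orbT.
Qed.

Lemma uniq_path_edges x p : uniq (x :: p) -> uniq (path_edges x p).
Proof.
elim: p x => [//|y p IHp] x; rewrite cons_uniq => /andP[xNp up] /=.
rewrite (IHp y up) andbT; apply: contra xNp => /path_edges_sub; apply.
by rewrite !inE eqxx.
Qed.

Lemma path_edges_edges x p e :
  uniq (x :: p) -> e \in path_edges x p -> edges e.
Proof.
elim: p x => [//|y p IHp] x; rewrite cons_uniq => /andP[xNp up] /=.
rewrite inE => /orP[/eqP ->|]; last exact: IHp.
rewrite /edges /= cardfs2 (_ : x != y) //.
by apply: contraNneq xNp => ->; rewrite mem_head.
Qed.

Lemma adjacent_path_present (G : {fset V} -> bool) x p :
  path (Defs.adjacent G) x p -> all G (path_edges x p).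
Proof.
by elim: p x => //= y p IHp x /andP[/andP[_ ->] /IHp].
Qed.

End PathEdges.

Section IndependenceOnLists.
Context {R : realType} {disp : measure_display} {Omega : measurableType disp}.
Variable P : probability Omega R.

Lemma mutually_independent_seq disp' (T : measurableType disp') (I : choiceType)
    (D : set I) (X : I -> Omega -> T) (s : seq I) (B : I -> set T) :
  mutually_independent P D X -> uniq s -> [set` s] `<=` D ->
  (forall i, measurable (B i)) ->
  P (\bigcap_(i in [set` s]) (X i @^-1` B i)) =
  (\prod_(i <- s) P (X i @^-1` B i))%E.
Proof.
move=> indep us sD mB.
have mem_s i : (i \in [fset j in s]%fset) = (i \in s) by rewrite !inE.
have sE : [set` [fset i in s]%fset] = [set` s].
  by apply/seteqP; split=> i /=; rewrite mem_s.
rewrite -sE indep ?sE //; apply: perm_big; exact: uniq_perm.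
Qed.

Lemma sigma_bigcap_seq (G : set (set Omega)) (I : choiceType) (s : seq I)
    (E : I -> set Omega) :
  (forall i, i \in s -> <<s G >> (E i)) ->
  <<s G >> (\bigcap_(i in [set` s]) E i).
Proof.
move=> sE; apply: (@fin_bigcap_measurable _ (g_sigma_algebraType G)) => //.
Qed.

End IndependenceOnLists.

Section PathMoments.
Context {R : realType} {d : nat}.
Local Notation V := 'rV[int]_d.
Context (alpha lambda kappa : R) (muW muL : probability R R)
  (disp : measure_display) (Omega : measurableType disp)
  (P : probability Omega R) (W : V -> {RV P >-> R})
  (present : {fset V} -> {RV P >-> bool}) (L : {fset V} -> {RV P >-> R}).
Hypothesis sfp : weighted_sfp alpha lambda muW muL W present L.
Hypothesis lambda_ge0 : 0 <= lambda.
Hypothesis kappa01 : 0 <= kappa <= 1.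
Hypothesis W_ge1 : muW `[1, +oo[%classic = 1%E.

Definition path_present (x : V) (p : seq V) : set Omega :=
  [set w | all (present ^~ w) (path_edges x p)].

(** The part of the bound on the connection probability that does not depend on the weights. *)
Definition edge_bound (u v : V) : R :=
  Num.max 1 lambda `^ kappa * enorm (u - v) `^ (- (alpha * kappa)).

Lemma path_presentE x p : path_present x p =
  \bigcap_(e in [set` path_edges x p]) (present e @^-1` [set true]).
Proof.
apply/seteqP; split=> w /=; first by move=> /allP h e /= /h.
by move=> h; apply/allP => e /h.
Qed.

Lemma measurable_path_present x p : measurable (path_present x p).
Proof.
rewrite path_presentE; apply: fin_bigcap_measurable => // e _.
exact: measurable_funPTI.
Qed.

Lemma measurable_connection_prob (u v : V) :
  measurable_fun setT (fun w => connection_prob alpha lambda (W ^~ w) u v).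
Proof.
rewrite /connection_prob; case: (enorm (u - v) <= 1 :> R) => [|];
  first exact: measurable_cst.
apply: measurable_funB => //; apply: measurableT_comp => //.
apply: measurableT_comp => //; apply: measurable_funM => //.
by apply: measurable_funM => //; apply: measurable_funM.
Qed.

(** The event [A] that all weights on the path are at least 1 has full probability and lies in the
    sigma-algebra of the weights, so [sfp_present] turns the probability into an integral of
    connection probabilities. Their bounds separate into edge factors and a power at most [2 kappa]
    of each of the [size p + 1] independent weights. *)
Lemma path_present_le (x : V) (p : seq V) : uniq (x :: p) ->
  (P (path_present x p) <=
   (\prod_(c <- pairmap edge_bound x p) c)%:E *
   (\sum_(k <oo) (dyadic_coef kappa k)%:E * muW (dyadic_tail k))
     ^+ (size p).+1)%E.
Proof.
move=> up; pose A := \bigcap_(v in [set` x :: p]) (W v @^-1` `[1, +oo[).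
have mA : measurable A.
  by apply: fin_bigcap_measurable => // v _; exact: measurable_funPTI.
have mC := measurable_path_present x p.
have PA : P A = 1%E.
  rewrite /A (mutually_independent_seq (sfp_weight_indep sfp)) //.
  by rewrite big1_seq // => v _; rewrite -W_ge1 -(sfp_weight_law sfp v).
have PAC : (P (path_present x p) <= P (A `&` path_present x p))%E.
  have PnA : P (~` A) = 0%E by rewrite probability_setC // PA subee.
  rewrite -[leRHS]adde0 -PnA.
  have mAC : measurable (A `&` path_present x p) by exact: measurableI.
  have mnA : measurable (~` A) by exact: measurableC.
  apply: le_trans (measureU2 _ mAC mnA); apply: le_measure; rewrite ?inE //.
    exact: measurableU.
  by move=> w Cw; have [Aw|nAw] := pselect (A w); [left|right].
apply: le_trans PAC _.
pose s := pairmap (fun u v => (u, v)) x p.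
have sE : [seq [fset q.1; q.2]%fset | q <- s] = path_edges x p.
  exact: map_pairmap.
have s_neq : all (fun q => q.1 != q.2) s.
  rewrite /s; elim: (p) (x) up => //= z r IHr y; rewrite inE negb_or -andbA.
  by move=> /andP[-> /andP[_ /IHr]].
have -> : path_present x p =
    [set w | all (fun q => present [fset q.1; q.2]%fset w) s].
  by rewrite /path_present -sE; apply/funext => w; rewrite /= all_map.
rewrite (sfp_present sfp s_neq) ?sE ?uniq_path_edges //; last first.
  apply: sigma_bigcap_seq => v _; apply: sub_sigma_algebra.
  by exists v => //; exists `[1, +oo[%classic; rewrite ?setTI.
pose c := \prod_(c <- pairmap edge_bound x p) c.
have c_ge0 : 0 <= c.
  rewrite /c; elim: (p) (x) => [|z r IHr] y; rewrite /= ?big_nil // big_cons.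
  by rewrite mulr_ge0 // /edge_bound mulr_ge0 ?powR_ge0.
pose g w := (\prod_(v <- x :: p)
  step_series (dyadic_coef kappa) dyadic_tail (W v w))%E.
have g_ge0 w : (0 <= g w)%E.
  rewrite /g; elim: (x :: p) => [|v r IHr]; rewrite ?big_nil ?big_cons //.
  by rewrite mule_ge0 // step_series_ge0 // => k; exact: dyadic_coef_ge0.
have mg : measurable_fun setT g.
  apply: emeasurable_prod_ge0 => v; apply: measurableT_comp => //.
  apply: measurable_step_series; first exact: dyadic_coef_ge0.
  exact: measurable_dyadic_tail.
have conn_le w : A w -> 0 <= \prod_(q <- s)
    connection_prob alpha lambda (W ^~ w) q.1 q.2 <=
    c * \prod_(v <- x :: p) (W v w `^ kappa) ^+ 2.
  (* The maximum makes [a] at least 1 at every vertex, as [prod_pairmap_le_prod_sqr] requires, and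
     changes nothing on the path. *)
  move=> Aw; pose a v := Num.max 1 (W v w) `^ kappa.
  have W1 v : v \in x :: p -> 1 <= W v w.
    by move=> vp; have := Aw v vp; rewrite /= in_itv /= andbT.
  have a_ge1 v : 1 <= a v.
    rewrite /a -[leLHS](powRr0 (Num.max 1 (W v w))) ler_powR ?le_max ?lexx //.
    by case/andP: kappa01.
  have aE v : v \in x :: p -> a v = W v w `^ kappa.
    by move=> /W1 v1; rewrite /a (max_idPr v1).
  have -> : \prod_(v <- x :: p) (W v w `^ kappa) ^+ 2 =
            \prod_(v <- x :: p) a v ^+ 2.
    by apply: eq_big_seq => v vp; rewrite aE.
  have bound : 0 <= \prod_(q <- s) connection_prob alpha lambda (W ^~ w) q.1 q.2
      <= c * \prod_(b <- pairmap (fun u v => a u * a v) x p) b.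
    rewrite /c /s; move: W1 aE; clear -up lambda_ge0 kappa01.
    elim: p x up => [|z r IHr] y; first by rewrite /= !big_nil mulr1 ler01 lexx.
    rewrite cons_uniq => /andP[yNr ur] W1 aE; rewrite /= !big_cons.
    have [||conn_ge0 conn_le] := andP (IHr z ur _ _).
    - by move=> v vr; apply: W1; rewrite inE vr orbT.
    - by move=> v vr; apply: aE; rewrite inE vr orbT.
    have yz : y != z by apply: contraNneq yNr => ->; rewrite mem_head.
    have z_in : z \in y :: z :: r by rewrite !inE eqxx orbT.
    have y_in : y \in y :: z :: r by rewrite !inE eqxx.
    have /andP[c0 cle] := connection_prob_bounds alpha (w := W ^~ w) lambda_ge0
      kappa01 (W1 y y_in) (W1 z z_in) yz.
    rewrite mulr_ge0 //= mulrACA aE // (aE z) // ler_pM //.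
  case/andP: bound => -> /le_trans -> //.
  by rewrite ler_wpM2l // prod_pairmap_le_prod_sqr.
apply: (@le_trans _ _ (\int[P]_(w in A) (c%:E * g w))%E).
  apply: ge0_le_integral => //.
  - by move=> w /conn_le /andP[? _]; rewrite lee_fin.
  - apply/measurable_EFinP; apply: measurable_funTS.
    apply: measurable_prod => q _; exact: measurable_connection_prob.
  - by apply: measurable_funTS; exact: measurable_funeM.
  - move=> w Aw; have /andP[_ le_c] := conn_le w Aw.
    apply: (@le_trans _ _ (c * \prod_(v <- x :: p) (W v w `^ kappa) ^+ 2)%:E).
      by rewrite lee_fin.
    rewrite EFinM lee_wpmul2l ?lee_fin // /g -prodEFin.
    have W1 v : v \in x :: p -> 1 <= W v w.
      by move=> vp; have := Aw v vp; rewrite /= in_itv /= andbT.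
    elim: (x :: p) W1 => [|v r IHr] W1; first by rewrite !big_nil.
    rewrite !big_cons; apply: lee_pmul => //.
    + by rewrite lee_fin sqr_ge0.
    + by rewrite prodEFin lee_fin prodr_ge0 // => u _; exact: sqr_ge0.
    + rewrite -powR_mulrn ?powR_ge0 // -powRrM mulrC.
      apply: powR_le_step_series; first by case/andP: kappa01.
      by apply: W1; rewrite mem_head.
    + by apply: IHr => u ur; apply: W1; rewrite inE ur orbT.
apply: (@le_trans _ _ (\int[P]_w (c%:E * g w))%E).
  apply: ge0_subset_integral => //; first exact: measurable_funeM.
  by move=> w _; rewrite mule_ge0 ?lee_fin.
rewrite ge0_integralZl_EFin // lee_wpmul2l ?lee_fin //.
have := @integral_prod_step_series _ _ _ P muW (dyadic_coef kappa) dyadic_tail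
  (dyadic_coef_ge0 kappa) measurable_dyadic_tail _ W (x :: p) setT up
  measurableT.
rewrite probability_setT mul1e => <-.
  under [leRHS]eq_integral do rewrite indicT mul1e.
  by [].
move=> D mD; rewrite setTI (mutually_independent_seq (sfp_weight_indep sfp)) //.
rewrite mul1e; apply: eq_bigr => v _; rewrite -(sfp_weight_law sfp v) //.
Qed.

(** The presence of the path lies in the sigma-algebra of the graph, so it can be the event [C] of
    the product formula, the variables being the lengths of the distinct edges of the path. *)
Lemma path_length_moment (a : nat -> R) (B : nat -> set R) (x : V) (p : seq V) :
  (forall k, 0 <= a k) -> (forall k, measurable (B k)) -> uniq (x :: p) ->
  (\int[P]_w ((\1_(path_present x p) w)%:E *
     \prod_(e <- path_edges x p) step_series a B (L e w)) =
   P (path_present x p) *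
   (\sum_(k <oo) (a k)%:E * muL (B k)) ^+ size p)%E.
Proof.
move=> a_ge0 mB up; have := @integral_prod_step_series _ _ _ P muL a B a_ge0 mB
  _ L (path_edges x p) (path_present x p) (uniq_path_edges up)
  (measurable_path_present x p).
rewrite size_pairmap; apply=> D mD; rewrite setIC muleC.
have -> : (\prod_(e <- path_edges x p) muL (D e) =
           P (\bigcap_(e in [set` path_edges x p]) (L e @^-1` D e)))%E.
  rewrite (mutually_independent_seq (sfp_length_indep sfp)) //.
  - apply: eq_big_seq => e ep.
    by rewrite -(sfp_length_law sfp (path_edges_edges up ep)).
  - exact: uniq_path_edges.
  - by move=> e; exact: path_edges_edges.
apply: (sfp_length_graph_indep sfp).
  apply: sigma_bigcap_seq => e ep; apply: sub_sigma_algebra.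
  exists e; first exact: path_edges_edges ep.
  by exists (D e); rewrite ?setTI.
rewrite path_presentE; apply: sigma_bigcap_seq => e ep; apply: sub_sigma_algebra.
right; exists e; first exact: path_edges_edges ep.
by exists [set true]; rewrite ?setTI.
Qed.

End PathMoments.

(** Numbering the paths lets the sum over them be a series, for measurability and exchange with the
    integral, and a sum over a countable set, for counting. *)
Lemma nneseries_pickle {R : realType} (T : countType) (b : T -> \bar R) :
  (forall t, 0 <= b t)%E ->
  (\sum_(k <oo) (if pickle_inv k is Some t then b t else 0) =
   \esum_(t in [set: T]) b t)%E.
Proof.
move=> b_ge0; pose c k : \bar R := if @pickle_inv T k is Some t then b t else 0%E.
have c_ge0 k : (0 <= c k)%E by rewrite /c; case: pickle_inv.
rewrite -/c (@nneseries_esumT _ c) //.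
have -> : (\esum_(k in [set: nat]) c k =
    \esum_(k in range (@choice.pickle T)) c k)%E.
  rewrite [RHS]esum_mkcond; apply: eq_esum => k _; case: ifPn => //.
  rewrite notin_setE /c; case kt : (pickle_inv k) => [t|//] [].
  by exists t => //; have := @pickle_invK T k; rewrite kt.
rewrite esum_image; last by move=> s t _ _; apply: (pcan_inj pickleK_inv).
by apply: eq_esum => t _; rewrite /c pickleK_inv.
Qed.

Lemma measurable_truncnS {R : realType} (disp : measure_display)
    (Omega : measurableType disp) (t : Omega -> R) :
  measurable_fun setT t -> (forall w, 0 <= t w) ->
  measurable_fun setT (fun w => (Num.truncn (t w)).+1).
Proof.
move=> mt t_ge0 _ Y _; rewrite setTI.
rewrite (_ : _ @^-1` _ = \bigcup_(k in [set k | Y k.+1])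
    (t @^-1` `[k%:R, k.+1%:R[%classic)).
  apply: bigcup_measurable => k _; rewrite -[_ @^-1` _]setTI.
  by apply: mt => //; exact: measurable_itv.
apply/seteqP; split=> w /=.
  by move=> Yw; exists (Num.truncn (t w)) => //=; rewrite in_itv /= truncn_itv.
by move=> [k /= Yk]; rewrite in_itv /= => /truncn_def ->.
Qed.

(** * Almost sure bound on the displacement of paths *)

Section Displacement.
Context {R : realType} {d : nat}.
Local Notation V := 'rV[int]_d.
(** The function [cost] covers both distances: the identity for weighted paths, the constant 1 for
    the graph distance. *)
Context (alpha lambda kappa s q theta : R) (muW muL : probability R R)
  (a : nat -> R) (B : nat -> set R) (cost : R -> R).
Hypothesis lambda_ge0 : 0 <= lambda.
Hypothesis kappa01 : 0 <= kappa <= 1.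
Hypothesis W_ge1 : muW `[1, +oo[%classic = 1%E.
Hypothesis s_gt0 : 0 < s.
Hypothesis a_ge0 : forall k, 0 <= a k.
Hypothesis B_meas : forall k, measurable (B k).
Hypothesis q_ge0 : 0 <= q.
Hypothesis lengths_small : (\sum_(k <oo) (a k)%:E * muL (B k) <= q%:E)%E.
Hypothesis theta_ge0 : 0 <= theta.
Hypothesis cost_le : forall l,
  ((expR (- (theta * cost l)))%:E <= step_series a B l)%E.

Let moment := (\sum_(k <oo) (dyadic_coef kappa k)%:E * muW (dyadic_tail k))%E.
Hypothesis moment_fin : (moment < +oo)%E.

(** All factors of one edge: [2 ^ s] from the doubled step length, the constant of the connection
    bound, one vertex moment, and the bound [q] for the length. *)
Let C0 := 2 `^ s * Num.max 1 lambda `^ kappa * fine moment * q.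
Hypothesis edge_sum_le :
  (\esum_(v in [set: V]) (C0 * enorm v `^ (- (alpha * kappa - s)))%:E
    <= (2^-1)%:E)%E.

Let momentE : moment = (fine moment)%:E.
Proof.
rewrite fineK // ge0_fin_numE //; apply: nneseries_ge0 => k _ _.
by rewrite mule_ge0 // lee_fin dyadic_coef_ge0.
Qed.

Let moment_ge0 : 0 <= fine moment.
Proof.
apply: fine_ge0; apply: nneseries_ge0 => k _ _.
by rewrite mule_ge0 // lee_fin dyadic_coef_ge0.
Qed.

Let C0_ge0 : 0 <= C0.
Proof. by rewrite /C0 !mulr_ge0 // powR_ge0. Qed.

Context (disp : measure_display) (Omega : measurableType disp)
  (P : probability Omega R) (W : V -> {RV P >-> R})
  (present : {fset V} -> {RV P >-> bool}) (L : {fset V} -> {RV P >-> R}).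
Hypothesis sfp : weighted_sfp alpha lambda muW muL W present L.

(** Lists that are not self-avoiding get weight 0, so that the sum may range over all lists of
    vertices. *)
Definition path_weight (x : V) (p : seq V) (w : Omega) : \bar R :=
  (if uniq (x :: p) then
    ((\prod_(c <- pairmap (fun u v => 2 * enorm (u - v)) x p) c) `^ s)%R%:E *
    ((\1_(path_present present x p) w)%:E *
     \prod_(e <- path_edges x p) step_series a B (L e w))
  else 0)%E.

Let steps_ge0 (x : V) (p : seq V) (w : Omega) :
  (0 <= \prod_(e <- path_edges x p) step_series a B (L e w))%E.
Proof.
elim: (path_edges x p) => [|e r IHr]; rewrite ?big_nil ?big_cons //.
by rewrite mule_ge0 // step_series_ge0.
Qed.

Lemma path_weight_ge0 x p w : (0 <= path_weight x p w)%E.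
Proof.
rewrite /path_weight; case: ifP => // _.
by rewrite !mule_ge0 // lee_fin ?powR_ge0 // indicE.
Qed.

Lemma measurable_path_weight x p : measurable_fun setT (path_weight x p).
Proof.
rewrite /path_weight; case: (uniq _); last exact: measurable_cst.
apply: measurable_funeM; apply: emeasurable_funM.
  apply/measurable_EFinP; apply: measurable_indic.
  exact: measurable_path_present.
apply: emeasurable_prod_ge0 => e; apply: measurableT_comp => //.
exact: measurable_step_series.
Qed.

(** A path with [n] edges has [n + 1] vertices: one moment goes into each edge factor [C0], and the
    one left over stands in front. *)
Lemma integral_path_weight_le x p :
  (\int[P]_w path_weight x p w <= moment *
    \prod_(c <- pairmap (fun u v =>
      (C0 * enorm (u - v) `^ (- (alpha * kappa - s)))%:E) x p) c)%E.
Proof.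
have prod_ge0 : (0 <= \prod_(c <- pairmap (fun u v =>
    (C0 * enorm (u - v) `^ (- (alpha * kappa - s)))%:E) x p) c)%E.
  elim: (p) (x) => [|z r IHr] y; rewrite /= ?big_nil // big_cons mule_ge0 //.
  by rewrite lee_fin mulr_ge0 ?powR_ge0.
rewrite /path_weight; case up : (uniq (x :: p)); last first.
  by rewrite integral0 mule_ge0 // momentE lee_fin.
have mC := measurable_path_present present x p.
rewrite ge0_integralZl_EFin ?powR_ge0 //; last 2 first.
- by move=> w _; rewrite mule_ge0 // lee_fin indicE.
- apply: emeasurable_funM; first exact/measurable_EFinP.
  apply: emeasurable_prod_ge0 => e; apply: measurableT_comp => //.
  exact: measurable_step_series.
rewrite (path_length_moment sfp) //.
have q_le : ((\sum_(k <oo) (a k)%:E * muL (B k)) ^+ size p <= (q ^+ size p)%:E)%E.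
  rewrite EFin_expe; elim: (size p) => // n IHn.
  rewrite !expeS lee_pmul ?expe_ge0 //; apply: nneseries_ge0 => k _ _;
    by rewrite mule_ge0 // lee_fin.
have P_le := path_present_le sfp lambda_ge0 kappa01 W_ge1 up.
rewrite -/moment in P_le.
apply: (@le_trans _ _ (((\prod_(c <- pairmap (fun u v => 2 * enorm (u - v)) x p) c)
    `^ s)%:E * (((\prod_(c <- pairmap (edge_bound alpha lambda kappa) x p) c)%:E *
    moment ^+ (size p).+1) * (q ^+ size p)%:E))%E).
  apply: lee_wpmul2l; first by rewrite lee_fin powR_ge0.
  apply: lee_pmul => //; apply: expe_ge0; apply: nneseries_ge0 => k _ _.
  by rewrite mule_ge0 // lee_fin.
rewrite momentE -EFin_expe -!EFinM; set m := fine moment.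
rewrite [X in (_ <= _ * X)%E](_ : _ = (\prod_(c <- pairmap (fun u v =>
    C0 * enorm (u - v) `^ (- (alpha * kappa - s))) x p) c)%:E); last first.
  rewrite -prodEFin; elim: (p) (x) => [|z r IHr] y /=;
    rewrite ?big_nil // !big_cons.
  by rewrite IHr.
rewrite -EFinM lee_fin exprS le_eqVlt; apply/orP; left; apply/eqP.
clear prod_ge0 mC P_le q_le.
elim: p x up => [|z r IHr] y.
  by move=> _; rewrite /= !big_nil powR1 !expr0; ring.
rewrite cons_uniq => /andP[yNr ur]; have := IHr z ur; rewrite /= !big_cons.
have prod2_ge0 :
    0 <= \prod_(c <- pairmap (fun u v => 2 * enorm (u - v)) z r) c :> R.
  elim: (r) (z) => [|u t IHt] v; rewrite /= ?big_nil // big_cons mulr_ge0 //.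
  by rewrite mulr_ge0 ?enorm_ge0.
have e_ge1 : 1 <= enorm (y - z) :> R.
  apply: enorm_ge1; rewrite subr_eq0.
  by apply: contraNneq yNr => ->; rewrite mem_head.
rewrite powRM ?mulr_ge0 ?enorm_ge0 // (powRM _ _ (enorm_ge0 _)) //.
have -> : enorm (y - z) `^ (- (alpha * kappa - s)) =
    enorm (y - z) `^ s * enorm (y - z) `^ (- (alpha * kappa)) :> R.
  rewrite -powRD; first by congr (_ `^ _); ring.
  by rewrite (gt_eqF (lt_le_trans ltr01 e_ge1)) implybT.
set Q := (X in X `^ s * _ = _ -> _); set Q1 := \prod_(c <- _) c.
set Q2 := \prod_(c <- _) c => IH.
rewrite (exprS m) (exprS q) /edge_bound.
transitivity (C0 * enorm (y - z) `^ s * enorm (y - z) `^ (- (alpha * kappa)) *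
  (Q `^ s * (Q1 * (m * m ^+ size r) * q ^+ size r))).
  by rewrite /C0 -/m; ring.
by rewrite IH; ring.
Qed.


(** The weight of a single path is one term of the almost surely finite sum [Z]. The slack 1 in the
    cost is there because a distance is an infimum over paths. *)
Lemma displacement_bound (x : V) :
  exists t0 : {RV P >-> R}, (forall w, 0 <= t0 w) /\
    {ae P, forall w, forall (t : R) (p : seq V), t0 w <= t ->
      uniq (x :: p) -> all (present ^~ w) (path_edges x p) ->
      \sum_(e <- path_edges x p) cost (L e w) <= t + 1 ->
      enorm (x - last x p) <= expR ((theta + 1) / s * t)}.
Proof.
pose term k w : \bar R :=
  if @pickle_inv (seq V) k is Some p then path_weight x p w else 0%E.
pose Z w := (\sum_(k <oo) term k w)%E.
have term_ge0 k w : (0 <= term k w)%E.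
  by rewrite /term; case: pickle_inv => // p; exact: path_weight_ge0.
have mterm k : measurable_fun setT (term k).
  rewrite /term; case: pickle_inv => [p|]; last exact: measurable_cst.
  exact: measurable_path_weight.
have Z_ge0 w : (0 <= Z w)%E by apply: nneseries_ge0 => k _ _; exact: term_ge0.
have mZ : measurable_fun setT Z by exact: ge0_emeasurable_sum.
pose f (u v : V) := (C0 * enorm (u - v) `^ (- (alpha * kappa - s)))%:E.
have f_ge0 u v : (0 <= f u v)%E by rewrite lee_fin mulr_ge0 ?powR_ge0.
have f_sum u : (\esum_(v in [set: V]) f u v <= (2^-1)%:E)%E.
  pose g (v : V) := (C0 * enorm v `^ (- (alpha * kappa - s)))%:E.
  rewrite -[leLHS]/(\esum_(v in setT) g (u - v)%R)%E.
  (* Translation invariance: [u - v] runs over the lattice exactly as [v] does. *)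
  rewrite -(@reindex_esum _ _ _ setT setT (fun v => u - v) g) //.
  split=> // [v w _ _ /addrI /oppr_inj //|v _].
  by exists (u - v) => //; rewrite opprB addrC subrK.
have prod_ge0 p : (0 <= \prod_(c <- pairmap f x p) c)%E.
  by elim: p (x) => [|z r IHr] y; rewrite /= ?big_nil // big_cons mule_ge0.
have intZ : (\int[P]_w Z w < +oo)%E.
  rewrite integral_nneseries //.
  apply: (@le_lt_trans _ _ (\sum_(k <oo) (if @pickle_inv (seq V) k is Some p
      then moment * \prod_(c <- pairmap f x p) c else 0))%E).
    apply: lee_nneseries => k _; first by move=> _; exact: integral_ge0.
    rewrite /term; case: pickle_inv => [p|]; last by rewrite integral0.
    exact: integral_path_weight_le.
  have moment_ge0E : (0 <= moment)%E by rewrite momentE lee_fin.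
  rewrite (nneseries_pickle
    (b := fun p => moment * \prod_(c <- pairmap f x p) c)%E);
    last by move=> p; exact: mule_ge0.
  apply: le_lt_trans (esumZl_le _ _ _) _ => //.
  apply: (@le_lt_trans _ _ (moment * \sum_(n <oo) (2^-1)%:E ^+ n)%E).
    by rewrite lee_wpmul2l //; exact: esum_seq_le.
  rewrite momentE lte_mul_pinfty ?lee_fin //.
  apply: (@nneseries_geometric_fin _ _ 1 2^-1) => //.
    by apply/andP; split; lra.
  by move=> k; rewrite -EFin_expe !lee_fin mul1r lexx exprn_ge0.
(* For [t] above this threshold, [Z exp theta <= t <= exp t]; the factor [exp theta] pays for the
   slack 1 in the cost. *)
pose t0 w := fine (Z w) * expR theta.
have mt0 : measurable_fun setT t0.
  apply: measurable_funM => //; apply: measurableT_comp mZ.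
  exact: fine_measurable.
exists (mfun_Sub (mem_set mt0)); split.
  by move=> w; rewrite mfun_valP mulr_ge0 ?expR_ge0 ?fine_ge0.
have Z_int : P.-integrable setT Z.
  apply/integrableP; split=> //.
  by under eq_integral => w _ do rewrite gee0_abs //.
have := integrable_ae measurableT Z_int; apply: filterS => w /(_ I) Z_fin t p.
rewrite mfun_valP => t0_le up present_p cost_p.
have t_ge0 : 0 <= t.
  by apply: le_trans t0_le; rewrite mulr_ge0 ?expR_ge0 ?fine_ge0.
pose steps : R := \prod_(c <- pairmap (fun u v => 2 * enorm (u - v)) x p) c.
have disp_le := @enorm_last_le R d x p up.
rewrite -/steps ge_max in disp_le; have /andP[steps_ge1 steps_ge] := disp_le.
have weight_le : ((steps `^ s)%:E * (expR (- (theta * (t + 1))))%:E <= Z w)%E.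
  apply: (@le_trans _ _ (path_weight x p w)); last first.
    rewrite (_ : path_weight x p w = term (choice.pickle p) w); last first.
      by rewrite /term pickleK_inv.
    apply: le_trans (nneseries_lim_ge (choice.pickle p).+1 _) => //.
    by rewrite big_nat_recr //= leeDr // sume_ge0.
  rewrite /path_weight up lee_wpmul2l ?lee_fin ?powR_ge0 //.
  rewrite indicE mem_set // mul1e.
  apply: (@le_trans _ _ (\prod_(e <- path_edges x p)
      (expR (- (theta * cost (L e w))))%:E)%E).
    rewrite prodEFin -expR_sum lee_fin ler_expR sumrN -mulr_sumr lerN2.
    by rewrite ler_wpM2l.
  elim: (path_edges x p) => [|e r IHr]; rewrite ?big_nil // !big_cons.
  apply: lee_pmul => //.
  by rewrite prodEFin lee_fin prodr_ge0 // => ? _; exact: expR_ge0.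
have steps_le : steps `^ s <= expR ((theta + 1) * t).
  have : steps `^ s * expR (- (theta * (t + 1))) <= fine (Z w).
    by rewrite -lee_fin fineK.
  rewrite expRN ler_pdivrMr ?expR_gt0 // => /le_trans -> //.
  rewrite mulrDr mulr1 expRD [expR (theta * t) * _]mulrC mulrA.
  rewrite [leRHS](_ : _ = expR t * expR (theta * t)); last first.
    by rewrite -expRD; congr expR; ring.
  rewrite ler_pM2r ?expR_gt0 //; apply: le_trans t0_le _.
  by have := expR_ge1Dx t; lra.
apply: le_trans steps_ge _.
have steps_pos : 0 <= steps by exact: le_trans steps_ge1.
rewrite -[leLHS](powRr1 steps_pos).
rewrite -[X in _ `^ X <= _](divff (lt0r_neq0 s_gt0)) powRrM.
rewrite (_ : expR _ = expR ((theta + 1) * t) `^ s^-1); last first.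
  by rewrite -expRM mulrAC.
by apply: ge0_ler_powR;
  rewrite ?nnegrE ?powR_ge0 ?expR_ge0 ?invr_ge0 ?(ltW s_gt0).
Qed.

End Displacement.

(** * Lengths *)

(** Continuity from above along the half-lines up to [1 / (n + 1)], which decrease to the null
    half-line up to 0. *)
Lemma small_itvNyc {R : realType} (mu : probability R R) (e : R) :
  0 < e -> mu `]-oo, 0]%classic = 0%E ->
  exists2 r : R, 0 < r & (mu `]-oo, r]%classic <= e%:E)%E.
Proof.
move=> e_gt0 mu0; pose F (n : nat) : set R := `]-oo, n.+1%:R^-1]%classic.
have F0 : \bigcap_n F n = `]-oo, 0]%classic.
  apply/seteqP; split=> t /=; rewrite in_itv /=; last first.
    by move=> t_le0 n _; rewrite /F /= in_itv /= (le_trans t_le0).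
  move=> Ft; rewrite leNgt; apply/negP => t_gt0.
  have := Ft (Num.truncn t^-1) I; rewrite /F /= in_itv /= leNgt => /negP; apply.
  by rewrite -[ltRHS]invrK ltf_pV2 ?posrE ?invr_gt0 ?ltr0n // truncnS_gt.
have : mu \o F @ \oo --> mu (\bigcap_n F n).
    apply: nonincreasing_cvg_mu.
  - by rewrite /= -ge0_fin_numE // fin_num_measure //; exact: measurable_itv.
  - by move=> n; exact: measurable_itv.
  - by rewrite F0; exact: measurable_itv.
  - move=> m n mn; apply/subsetPset => t; rewrite /F /= !in_itv /=.
    by move=> /le_trans; apply; rewrite lef_pV2 ?posrE ?ltr0n // ler_nat.
rewrite F0 mu0 => /fine_cvgP[_ /cvgrPdist_le/(_ _ e_gt0)[N _ /(_ N)]] /=.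
rewrite leqnn => /(_ isT); rewrite sub0r normrN => le_e.
exists N.+1%:R^-1; first by rewrite invr_gt0.
rewrite -[leLHS]fineK ?fin_num_measure // lee_fin.
exact: le_trans (ler_norm _) le_e.
Qed.

(* A length [l < 0] makes the series infinite, at no cost in expectation. *)
Lemma length_step_series {R : realType} (mu : probability R R) (q : R) :
  0 < q -> q <= 1 -> mu `]-oo, 0]%classic = 0%E ->
  exists a B theta, [/\ forall k, 0 <= a k, forall k, measurable (B k),
    (\sum_(k <oo) (a k)%:E * mu (B k) <= q%:E)%E, 0 <= theta &
    forall l : R, ((expR (- (theta * l)))%:E <= step_series a B l)%E].
Proof.
move=> q_gt0 q_le1 mu0; have q2_gt0 : 0 < q / 2 by lra.
have [r r_gt0 mu_r] := small_itvNyc q2_gt0 mu0.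
(* The constant [q / 2] serves lengths above [r], the indicator of []-oo, r]] those in [[0, r]], and
   each costs at most [q / 2] in expectation. The other indicators live on the null set of negative
   lengths. *)
pose a (k : nat) : R := if k is 0%N then q / 2 else 1.
pose B (k : nat) : set R := match k with
  0%N => setT | 1%N => `]-oo, r]%classic | _ => `]-oo, 0[%classic end.
have a_ge0 k : 0 <= a k by case: k => //=; exact: ltW.
have mB k : measurable (B k).
  by case: k => [|[|k]]; [exact: measurableT | exact: measurable_itv..].
have mu_neg : mu `]-oo, 0[%classic = 0%E.
  apply/eqP; rewrite eq_le measure_ge0 andbT -mu0.
  apply: le_measure; rewrite ?inE; [exact: measurable_itv..|].
  by move=> t; rewrite /= !in_itv /=; exact: ltW.
(* This [theta] solves [exp (- theta r) = q / 2]. *)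
exists a, B, (- ln (q / 2) / r); split=> //.
- apply: nneseries_le_ub => [k|n]; first by rewrite mule_ge0 // lee_fin.
  apply: (@le_trans _ _ (\sum_(0 <= k < n.+2) (a k)%:E * mu (B k))%E).
    rewrite [leRHS](@big_cat_nat _ _ _ n) //=; last by rewrite leqW.
    by rewrite leeDl // sume_ge0 // => k _; rewrite mule_ge0 // lee_fin.
  rewrite big_nat_recl // big_nat_recl //= big1 => [|k _]; last first.
    by rewrite mu_neg mule0.
  rewrite adde0 probability_setT mule1 mul1e.
  apply: (@le_trans _ _ ((q / 2)%:E + (q / 2)%:E)%E); first by rewrite leeD2l.
  by rewrite -EFinD lee_fin; lra.
- rewrite divr_ge0 ?(ltW r_gt0) // oppr_ge0 ln_le0 //; lra.
move=> l; have [l_lt0|l_ge0] := ltP l 0.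
  rewrite (_ : step_series a B l = +oo%E) ?leey //.
  apply/eqyP => A A_gt0; pose n := (Num.truncn A).+1.
  have Bl k : B k.+1 l.
    by case: k => [|k]; rewrite /= in_itv /= ?ltW // (lt_trans l_lt0).
  apply: (@le_trans _ _ (n%:R%:E)); first by rewrite lee_fin ltW // truncnS_gt.
  apply: le_trans (nneseries_lim_ge n.+1 (fun k _ _ => step_ge0 B a_ge0 k l)).
  rewrite big_nat_recl // (eq_bigr (fun=> 1%E)); last first.
    by move=> k _; rewrite indicE mem_set // mulr1.
  rewrite sumEFin big_const_nat subn0 iter_addr_0 leeDr //.
  exact: step_ge0.
have [lr|rl] := leP l r.
  have B1 : B 1%N l by rewrite /= in_itv.
  apply: le_trans (le_step_series a_ge0 B1); rewrite lee_fin /= expR_le1.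
  rewrite oppr_le0 mulr_ge0 // divr_ge0 ?(ltW r_gt0) // oppr_ge0 ln_le0 //; lra.
apply: le_trans (@le_step_series _ a B a_ge0 0%N l I); rewrite lee_fin /=.
rewrite -[leRHS](lnK (x := q / 2)) ?posrE // ler_expR mulNr mulNr opprK.
rewrite mulrAC -mulrA -[leRHS]mulr1 ler_wnM2l //.
  by rewrite ln_le0 //; lra.
by rewrite ler_pdivlMr // mul1r ltW.
Qed.

(** * Choice of the exponents and constants *)

Theorem theorem1p8 (R : realType) (d : nat) (alpha lambda tau : R)
  (muW muL : probability R R) (ell : R -> R)
  (d_ge1 : (1 <= d)%N) (alpha_gtd : d%:R < alpha) (lambda_gt0 : 0 < lambda)
  (tau_gt1 : 1 < tau)
  (W_ge1 : muW `[1, +oo[%classic = 1%E)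
  (ell_slow : slowly_varying ell)
  (W_tail : forall t : R, 0 < t ->
    muW `]t, +oo[%classic = (ell t / t `^ (tau - 1))%:E)
  (L_ge0 : muL `[0, +oo[%classic = 1%E)
  (FL0 : muL `]-oo, 0]%classic = 0%E)
  (gamma_gt2 : 2 < alpha * (tau - 1) / d%:R) :
  exists C C' : R, [/\ 0 < C, 0 < C' &
    forall (disp : measure_display) (Omega : measurableType disp)
      (P : probability Omega R) (W : 'rV[int]_d -> {RV P >-> R})
      (present : {fset 'rV[int]_d} -> {RV P >-> bool})
      (L : {fset 'rV[int]_d} -> {RV P >-> R}),
      weighted_sfp alpha lambda muW muL W present L ->
      forall x : 'rV[int]_d,
        exists (n0 : {RV P >-> nat}) (t0 : {RV P >-> R}),
          {ae P, forall w,
            (forall n : nat, (n0 w <= n)%N ->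
              graph_ball (R := R) (present ^~ w) x n
                `<=` eball x (expR (C * n%:R))) /\
            (forall t : R, t0 w <= t ->
              weighted_ball (present ^~ w) (L ^~ w) x t
                `<=` eball x (expR (C' * t)))}].
Proof.
have d_gt0 : 0 < d%:R :> R by rewrite ltr0n.
have alpha_gt0 : 0 < alpha := lt_trans d_gt0 alpha_gtd.
(* [alpha > d] and [gamma > 2] say that [d / alpha] is below 1 and below [(tau - 1) / 2]; [kappa] is
   taken halfway between [d / alpha] and [m]. *)
pose m := Num.min 1 ((tau - 1) / 2).
have dm : d%:R / alpha < m.
  rewrite lt_min ltr_pdivrMr // mul1r alpha_gtd /= ltr_pdivrMr //.
  by move: gamma_gt2; rewrite ltr_pdivlMr //; lra.
have m_le1 : m <= 1 by rewrite ge_min lexx.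
have m_le : m <= (tau - 1) / 2 by rewrite ge_min lexx orbT.
have da_gt0 : 0 < d%:R / alpha by exact: divr_gt0.
pose kappa := (d%:R / alpha + m) / 2.
have kappa_m : kappa < m by rewrite /kappa; lra.
have d_kappa : d%:R / alpha < kappa by rewrite /kappa; lra.
have kappa01 : 0 <= kappa <= 1 by apply/andP; split; lra.
have kappa_tau : 2 * kappa < tau - 1 by lra.
have d_lt : d%:R < alpha * kappa by rewrite mulrC -ltr_pdivrMr.
(* Half of the excess of [alpha kappa] over [d], so that [alpha kappa - s] still exceeds [d]. *)
pose s := (alpha * kappa - d%:R) / 2.
have s_gt0 : 0 < s by rewrite /s; lra.
have edge_fin := @esum_enorm_fin R d (alpha * kappa - s) d_ge1 _.
have {}edge_fin := edge_fin ltac:(rewrite /s; lra).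
have moment_fin := dyadic_moment_fin ell_slow W_tail kappa_tau.
set moment := (\sum_(k <oo) _)%E in moment_fin.
set S := (\esum_(v in _) _)%E in edge_fin.
have moment_ge0 : (0 <= moment)%E.
  by apply: nneseries_ge0 => k _ _; rewrite mule_ge0 // lee_fin dyadic_coef_ge0.
have S_ge0 : (0 <= S)%E by apply: esum_ge0 => v _; rewrite lee_fin powR_ge0.
pose K := 2 `^ s * Num.max 1 lambda `^ kappa * fine moment.
have K_ge0 : 0 <= K by rewrite /K !mulr_ge0 ?powR_ge0 ?fine_ge0.
have fS_ge0 : 0 <= fine S by exact: fine_ge0.
(* Makes [K * fine S * q] at most 1/2; the added 1 keeps [q] at most 1 and avoids a division by
   0. *)
pose q := (2 * (K * fine S + 1))^-1.
have KS_ge0 : 0 <= K * fine S by exact: mulr_ge0.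
have q_gt0 : 0 < q by rewrite invr_gt0; lra.
have q_le1 : q <= 1 by rewrite invf_le1; lra.
have edge_sum_le : (\esum_(v in [set: 'rV[int]_d])
    (K * q * enorm v `^ (- (alpha * kappa - s)))%:E <= (2^-1)%:E)%E.
  under eq_esum => v _ do rewrite EFinM.
  apply: le_trans (esumZl_le _ _ _) _.
  - by rewrite lee_fin mulr_ge0 // ltW.
  - by move=> v; rewrite lee_fin powR_ge0.
  rewrite -/S -(fineK (x := S)); last by rewrite ge0_fin_numE.
  rewrite -EFinM lee_fin mulrAC /q ler_pdivrMr; lra.
have [a [B [theta [a_ge0 mB aB_le theta_ge0 length_le]]]] :=
  length_step_series q_gt0 q_le1 FL0.
(* For the graph distance every edge costs 1: with [theta = - ln q], the constant series [q] equals
   [exp (- theta)]. *)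
pose a' (k : nat) : R := if k is 0%N then q else 0.
have a'_ge0 k : 0 <= a' k by case: k => //=; exact: ltW.
have a'_le : (\sum_(k <oo) (a' k)%:E * muL setT <= q%:E)%E.
  apply: nneseries_le_ub => [k|[|n]]; first by rewrite mule_ge0 // lee_fin.
    by rewrite big_geq // lee_fin ltW.
  rewrite big_nat_recl // big1 => [|k _]; last exact: mul0e.
  by rewrite adde0 probability_setT mule1.
have lnq_ge0 : 0 <= - ln q by rewrite oppr_ge0 ln_le0.
have count_le (l : R) : ((expR (- (- ln q * 1)))%:E
    <= step_series a' (fun=> setT) l)%E.
  rewrite mulr1 opprK lnK ?posrE //.
  exact: (@le_step_series _ a' (fun=> setT) a'_ge0 0%N l I).
exists ((- ln q + 1) / s), ((theta + 1) / s); split.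
- by rewrite divr_gt0 //; lra.
- by rewrite divr_gt0 //; lra.
move=> disp Omega P W present L sfp x.
have [n0 [n0_ge0 n0P]] := displacement_bound (ltW lambda_gt0) kappa01 W_ge1
  s_gt0 a'_ge0 (fun=> measurableT) (ltW q_gt0) a'_le lnq_ge0
  (cost := fun=> 1) count_le moment_fin edge_sum_le sfp x.
have [t0 [_ t0P]] := displacement_bound (ltW lambda_gt0) kappa01 W_ge1
  s_gt0 a_ge0 mB (ltW q_gt0) aB_le theta_ge0
  (cost := id) length_le moment_fin edge_sum_le sfp x.
have mn0 : measurable_fun setT (fun w => (Num.truncn (n0 w)).+1).
  exact: measurable_truncnS.
exists (mfun_Sub (mem_set mn0)), t0; apply: filterS2 n0P t0P => w n0w t0w; split.
- move=> n; rewrite mfun_valP => n0n y yball.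
  (* An infimum at most [n] yields a path of cost strictly below [n + 1]. *)
  have /ereal_inf_lt[_ [p /and3P[xp up /eqP <-] <-]] :
      (graph_dist (R := R) (present ^~ w) x y < (n%:R + 1)%:E)%E.
    by apply: le_lt_trans yball _; rewrite lte_fin ltrDl.
  rewrite lte_fin => p_lt; apply: n0w => //.
  + by apply: ltW; apply: lt_le_trans (truncnS_gt _) _; rewrite ler_nat.
  + exact: adjacent_path_present xp.
  + by rewrite big_const_seq count_predT iter_addr_0 ltW.
- move=> t t0t y yball.
  have /ereal_inf_lt[_ [p /and3P[xp up /eqP <-] <-]] :
      (weighted_dist (present ^~ w) (L ^~ w) x y < (t + 1)%:E)%E.
    by apply: le_lt_trans yball _; rewrite lte_fin ltrDl.
  rewrite lte_fin => p_lt; apply: t0w => //; last exact: ltW.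
  exact: adjacent_path_present xp.
Qed.
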